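(* If $G$ and $H$ are R-cores that are weakly relationally equivalent to each other, then $G$ and $H$ are isomorphic.
   Context: Graphs are finite and undirected, loops allowed. For a finite set $B$ and a relation $R\subseteq V_G\times B$ with full image (every $b\in B$ has some $v$ with $(v,b)\in R$), $G\ast R$ is the graph with vertex set $B$ and edge set $\{(a,b)\in B\times B: \exists (u,v)\in E_G,\ (u,a)\in R,\ (v,b)\in R\}$. All relations here are required to have full domain (every $v\in V_G$ is related to some $b\in B$). $G$ and $H$ are weakly relationally equivalent if there are relations $R\subseteq V_G\times V_H$ and $S\subseteq V_H\times V_G$ with $G\ast R=H$ and $H\ast S=G$; this is an equivalence relation. A graph is an R-core if it has the minimum number of vertices among all graphs in its weak relational equivalence class. *)

(* Defs.v *)
From mathcomp Require Import all_boot.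

Set Implicit Arguments.
Unset Strict Implicit.
Unset Printing Implicit Defensive.

(* Finite undirected graphs with vertex set V, loops allowed.  The edge set
   consists of ordered pairs and is symmetric; symmetry is stated as a boolean
   so that two graphs on V are equal iff their edge sets are. *)
Record graph (V : finType) := Graph {
  edges : {set V * V};
  edges_sym : [forall u, forall v, ((u, v) \in edges) == ((v, u) \in edges)]
}.

Definition isomorphic (V W : finType) (G : graph V) (H : graph W) : Prop :=
  exists f : V -> W, bijective f /\
    forall u v, ((u, v) \in edges G) = ((f u, f v) \in edges H).

Definition full_domain (V B : finType) (R : {set V * B}) : Prop :=
  forall v, exists b, (v, b) \in R.

Definition full_image (V B : finType) (R : {set V * B}) : Prop :=
  forall b, exists v, (v, b) \in R.

Definition star_edges (V B : finType) (G : graph V) (R : {set V * B}) :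
    {set B * B} :=
  [set ab | [exists u, exists v,
     [&& (u, v) \in edges G, (u, ab.1) \in R & (v, ab.2) \in R]]].

Lemma star_edges_sym (V B : finType) (G : graph V) (R : {set V * B}) :
  [forall a, forall b,
     ((a, b) \in star_edges G R) == ((b, a) \in star_edges G R)].
Proof.
have Gsym u v : (u, v) \in edges G -> (v, u) \in edges G.
  by have /forallP/(_ u)/forallP/(_ v)/eqP-> := edges_sym G.
have swap a b : (a, b) \in star_edges G R -> (b, a) \in star_edges G R.
  rewrite !inE => /existsP[u /existsP[v /and3P[/= uv ua vb]]].
  by apply/existsP; exists v; apply/existsP; exists u; rewrite Gsym ?ua ?vb.
apply/forallP => a; apply/forallP => b; apply/eqP.
by apply/idP/idP; apply: swap.
Qed.

(* The graph G * R on vertex set B.  It is total in R; the requirement that R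
   have full domain and full image is imposed where the operation is used. *)
Definition star (V B : finType) (G : graph V) (R : {set V * B}) : graph B :=
  Graph (star_edges_sym G R).

Definition weakly_rel_equiv (V W : finType) (G : graph V) (H : graph W) :
    Prop :=
  exists (R : {set V * W}) (S : {set W * V}),
    [/\ full_domain R /\ full_image R,
        full_domain S /\ full_image S,
        star G R = H
      & star H S = G].

Definition R_core (V : finType) (G : graph V) : Prop :=
  forall (W : finType) (K : graph W), weakly_rel_equiv G K -> #|V| <= #|W|.

(* Main.v *)
Require Import Defs.
From mathcomp Require Import all_boot.

(** If a relation [R] with [G * R = H] violated Hall's condition on [A], it would
    factor through the smaller vertex set [(V \ A) + N(A)], and the intermediate
    graph would contradict the minimality of [G].  So [R] contains an injection,
    which is a homomorphism from [G] to [H]; it is bijective because the two cores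
    have the same order.  The same holds from [H] to [G], so both graphs have the
    same number of edges and the homomorphism is an isomorphism. *)

Set Implicit Arguments.
Unset Strict Implicit.
Unset Printing Implicit Defensive.

(** * Hall's marriage theorem for finite relations *)

Definition neighbors (V B : finType) (R : {set V * B}) (A : {set V}) : {set B} :=
  [set b | [exists v in A, (v, b) \in R]].

Lemma neighborsP (V B : finType) (R : {set V * B}) (A : {set V}) b :
  reflect (exists2 v, v \in A & (v, b) \in R) (b \in neighbors R A).
Proof. by rewrite inE; apply: exists_inP. Qed.

Definition hall_condition (V B : finType) (R : {set V * B}) : bool :=
  [forall A : {set V}, #|A| <= #|neighbors R A|].

(* Rado's argument: in a relation minimal for Hall's condition, two neighbors
   [b], [c] of [v] would give deficient sets [A1], [A2] for [R] without [(v, b)],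
   resp. [(v, c)]; submodularity then makes [A1 :|: A2] or [A1 :&: A2 :\ v]
   deficient for [R]. *)
Lemma minimal_hall_functional (V B : finType) (R : {set V * B}) v b c :
  minset (@hall_condition V B) R -> (v, b) \in R -> (v, c) \in R -> b = c.
Proof.
move=> /minsetP[/forallP hallR minR] vb vc; apply/eqP/negP => /negP neq_bc.
have deficient d : (v, d) \in R ->
    exists A, #|neighbors (R :\ (v, d)) A| < #|A|.
  move=> vd; have /forallPn[A] : ~~ hall_condition (R :\ (v, d)).
    apply/negP => /minR/(_ (subD1set _ _)) eqR.
    by move: vd; rewrite -eqR !inE eqxx.
  by rewrite -ltnNge; exists A.
(* For [v] outside [A], deleting [(v, d)] leaves the neighbors of [A] unchanged, so [A] cannot
   become deficient. *)
have deficient_mem d A : #|neighbors (R :\ (v, d)) A| < #|A| -> v \in A.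
  apply: contraLR => vA; rewrite -leqNgt; apply: leq_trans (hallR A) _.
  apply: subset_leq_card; apply/subsetP => x /neighborsP[u uA ux].
  apply/neighborsP; exists u => //; rewrite !inE ux andbT xpair_eqE.
  by apply: contraNN vA => /andP[/eqP<-].
have [A1 lt1] := deficient b vb; have [A2 lt2] := deficient c vc.
have vA1 := deficient_mem _ _ lt1; have vA2 := deficient_mem _ _ lt2.
set P := neighbors _ A1 in lt1; set Q := neighbors _ A2 in lt2.
(* Only [v] loses neighbors: [b] is missing from its part of [P] but survives in [Q], since [b]
   differs from [c]; every other neighbor survives in [P]. *)
have subU : neighbors R (A1 :|: A2) \subset P :|: Q.
  apply/subsetP => x /neighborsP[u uA ux].
  have [uv | uv] := eqVneq u v; last first.
    rewrite inE; apply/orP; case/setUP: uA => uA; [left | right];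
      by apply/neighborsP; exists u; rewrite // !inE ux xpair_eqE (negPf uv).
  rewrite uv in ux; have [xb | xb] := eqVneq x b; rewrite inE; apply/orP.
    right; apply/neighborsP; exists v => //.
    by rewrite !inE ux andbT xpair_eqE eqxx xb.
  left; apply/neighborsP; exists v => //.
  by rewrite !inE ux andbT xpair_eqE eqxx.
(* With [v] removed, neither deletion affects the remaining vertices. *)
have subI : neighbors R ((A1 :&: A2) :\ v) \subset P :&: Q.
  apply/subsetP => x /neighborsP[u /setD1P[uv /setIP[uA1 uA2]] ux].
  by rewrite inE; apply/andP; split; apply/neighborsP; exists u;
    rewrite // !inE ux xpair_eqE (negPf uv).
have leU := leq_trans (hallR _) (subset_leq_card subU).
have leI := leq_trans (hallR _) (subset_leq_card subI).
have cardA := cardsUI A1 A2; rewrite (cardsD1 v (A1 :&: A2)) inE vA1 vA2 in cardA.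
(* The two strict bounds give [#|P| + #|Q| + 2 <= #|A1| + #|A2|], while [leU] and [leI] bound the
   right side by [#|P| + #|Q| + 1], the 1 counting [v]. *)
have := leq_add lt1 lt2.
by rewrite -cardA addSn addnS -(cardsUI P Q) addnCA add1n ltnS ltnNge leq_add.
Qed.

(** A minimal Hall subrelation is functional; Hall's condition on singletons makes it total, and on
    pairs makes it injective. *)
Theorem hall_marriage (V B : finType) (R : {set V * B}) :
  hall_condition R -> exists2 f : V -> B, injective f & forall v, (v, f v) \in R.
Proof.
move=> /minset_exists[M minM subMR]; have fun_M := minimal_hall_functional minM.
have /minsetP[/forallP hallM _] := minM.
have M_total v : exists b, (v, b) \in M.
  have := hallM [set v]; rewrite cards1 card_gt0 => /set0Pn[b].
  by case/neighborsP=> u /set1P->; exists b.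
exists (fun v => xchoose (M_total v)) => [u v eq_fuv | v]; last first.
  exact: (subsetP subMR) (xchooseP (M_total v)).
apply/eqP/negP => /negP neq_uv; have := hallM [set u; v].
rewrite cards2 neq_uv leqNgt => /negP; apply.
rewrite ltnS /= -(cards1 (xchoose (M_total u))) subset_leq_card //.
apply/subsetP => x /neighborsP[w /set2P[] -> wx]; apply/set1P.
  exact: fun_M wx (xchooseP (M_total u)).
by rewrite eq_fuv; apply: fun_M wx (xchooseP (M_total v)).
Qed.

(** * Composition of relations and its action on graphs *)

Definition rel_comp (V U W : finType) (D : {set V * U}) (E : {set U * W}) :
    {set V * W} :=
  [set p | [exists x, ((p.1, x) \in D) && ((x, p.2) \in E)]].

Lemma rel_compP (V U W : finType) (D : {set V * U}) (E : {set U * W}) v w :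
  reflect (exists2 x, (v, x) \in D & (x, w) \in E) ((v, w) \in rel_comp D E).
Proof.
rewrite inE; apply: (iffP existsP) => [[x /andP[]] | [x vx xw]]; exists x => //.
by rewrite vx.
Qed.

Lemma full_domain_comp (V U W : finType) (D : {set V * U}) (E : {set U * W}) :
  full_domain D -> full_domain E -> full_domain (rel_comp D E).
Proof.
move=> fullD fullE v; have [x vx] := fullD v; have [w xw] := fullE x.
by exists w; apply/rel_compP; exists x.
Qed.

Lemma full_image_comp (V U W : finType) (D : {set V * U}) (E : {set U * W}) :
  full_image D -> full_image E -> full_image (rel_comp D E).
Proof.
move=> fullD fullE w; have [x xw] := fullE w; have [v vx] := fullD x.
by exists v; apply/rel_compP; exists x.
Qed.

Lemma edges_inj (V : finType) : injective (@edges V).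
Proof.
by case=> e1 s1 [e2 s2] /= eq_e; case: e2 / eq_e s2 => s2;
  rewrite (bool_irrelevance s1 s2).
Qed.

Lemma star_edgesP (V B : finType) (G : graph V) (R : {set V * B}) a b :
  reflect (exists u v, [/\ (u, v) \in edges G, (u, a) \in R & (v, b) \in R])
          ((a, b) \in edges (star G R)).
Proof.
rewrite inE; apply: (iffP existsP).
  by case=> u /existsP[v /and3P[]]; exists u, v.
by case=> u [v [uv ua vb]]; exists u; apply/existsP; exists v; apply/and3P.
Qed.

Lemma star_comp (V U W : finType) (G : graph V) (D : {set V * U})
    (E : {set U * W}) :
  star (star G D) E = star G (rel_comp D E).
Proof.
apply: edges_inj; apply/setP => -[a b]; apply/star_edgesP/star_edgesP.
  case=> x [y [/star_edgesP[u [v [uv ux vy]]] xa yb]].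
  exists u, v; split=> //; apply/rel_compP; [by exists x | by exists y].
case=> u [v [uv /rel_compP[x ux xa] /rel_compP[y vy yb]]].
by exists x, y; split=> //; apply/star_edgesP; exists u, v.
Qed.

Lemma weakly_rel_equiv_sym (V W : finType) (G : graph V) (H : graph W) :
  weakly_rel_equiv G H -> weakly_rel_equiv H G.
Proof. by case=> R [S [fullR fullS GR HS]]; exists S, R. Qed.

(** * Factoring a relation through a smaller vertex set *)

Section DeficientFactorization.

Variables (V W : finType) (R : {set V * W}) (A : {set V}).

Let U := ({v : V | v \notin A} + {w : W | w \in neighbors R A})%type.

(** Vertices outside [A] stay fixed, while those in [A] already move along [R]; [deficient_snd] then
    applies [R] to the former and fixes the images of the latter. *)
Definition deficient_fst : {set V * U} :=
  [set p | match p.2 with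
           | inl v => val v == p.1
           | inr w => (p.1 \in A) && ((p.1, val w) \in R)
           end].

Definition deficient_snd : {set U * W} :=
  [set p | match p.1 with
           | inl v => (val v, p.2) \in R
           | inr w => val w == p.2
           end].

Lemma deficient_comp : rel_comp deficient_fst deficient_snd = R.
Proof.
apply/setP => -[v w]; apply/rel_compP/idP => [[[x | x]] | vw].
- by rewrite !inE /= => /eqP->.
- by rewrite !inE /= => /andP[_ vx] /eqP<-.
have [vA | vA] := boolP (v \in A); last first.
  by exists (inl (exist _ v vA)); rewrite !inE /=.
have wN : w \in neighbors R A by apply/neighborsP; exists v.
by exists (inr (exist _ w wN)); rewrite !inE //= vA.
Qed.

Lemma full_domain_deficient_fst : full_domain R -> full_domain deficient_fst.
Proof.
move=> fullR v; have [w vw] := fullR v.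
have /rel_compP[x vx _] : (v, w) \in rel_comp deficient_fst deficient_snd.
  by rewrite deficient_comp.
by exists x.
Qed.

Lemma full_image_deficient_fst : full_image deficient_fst.
Proof.
case=> [v | [w wN]]; first by exists (val v); rewrite inE /=.
by have /neighborsP[v vA vw] := wN; exists v; rewrite inE /= vA.
Qed.

Lemma full_domain_deficient_snd : full_domain R -> full_domain deficient_snd.
Proof.
move=> fullR [v | w]; last by exists (val w); rewrite inE /=.
by have [w vw] := fullR (val v); exists w; rewrite inE.
Qed.

Lemma full_image_deficient_snd : full_image R -> full_image deficient_snd.
Proof.
move=> fullR w; have [v vw] := fullR w.
have /rel_compP[x _ xw] : (v, w) \in rel_comp deficient_fst deficient_snd.
  by rewrite deficient_comp.
by exists x.
Qed.

(** Stated additively to avoid truncated subtraction. *)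
Lemma card_deficient : #|{: U}| + #|A| = #|V| + #|neighbors R A|.
Proof.
rewrite card_sum !card_sig addnAC -(cardC A); congr (_ + _).
by rewrite addnC; congr (_ + _); apply: eq_card.
Qed.

End DeficientFactorization.

(** The way back from [star G D] to [G] is [E] followed by [S], because [D] followed by [E] is [R].
    Minimality of [G] then bounds [#|V|] by the order of the intermediate graph. *)
Lemma R_core_hall (V W : finType) (G : graph V) (R : {set V * W})
    (S : {set W * V}) :
  R_core G -> full_domain R -> full_image R -> full_domain S -> full_image S ->
  star (star G R) S = G -> hall_condition R.
Proof.
move=> coreG domR imR domS imS GRS; apply/forallP => A.
set D := deficient_fst R A; set E := deficient_snd R A.
suff /coreG le_VU : weakly_rel_equiv G (star G D).
  by rewrite -(leq_add2l #|V|) -card_deficient leq_add2r.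
exists D, (rel_comp E S); split=> //.
- by split; [apply: full_domain_deficient_fst | apply: full_image_deficient_fst].
- split; first by apply: full_domain_comp => //; apply: full_domain_deficient_snd.
  by apply: full_image_comp => //; apply: full_image_deficient_snd.
by rewrite -star_comp (star_comp G) deficient_comp.
Qed.

(** * From injective homomorphisms to an isomorphism *)

Lemma R_core_injective_hom (V W : finType) (G : graph V) (H : graph W) :
  R_core G -> weakly_rel_equiv G H ->
  exists2 f : V -> W, injective f &
    forall u v, (u, v) \in edges G -> (f u, f v) \in edges H.
Proof.
move=> coreG [R [S [[domR imR] [domS imS] GR HS]]].
have GRS : star (star G R) S = G by rewrite GR.
have [f inj_f fR] := hall_marriage (R_core_hall coreG domR imR domS imS GRS).
by exists f => // u v uv; rewrite -GR; apply/star_edgesP; exists u, v.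
Qed.

Definition edge_map (V W : Type) (f : V -> W) (p : V * V) : W * W :=
  (f p.1, f p.2).

Lemma edge_map_inj (V W : Type) (f : V -> W) :
  injective f -> injective (edge_map f).
Proof. by move=> inj_f [a b] [c d] [/inj_f-> /inj_f->]. Qed.

Lemma hom_edges (V W : finType) (G : graph V) (H : graph W)
    (f : V -> W) :
  (forall u v, (u, v) \in edges G -> (f u, f v) \in edges H) ->
  edge_map f @: edges G \subset edges H.
Proof.
by move=> hom_f; apply/subsetP => _ /imsetP[[u v] uv ->]; apply: hom_f.
Qed.

Theorem proposition4p2p9 (V W : finType) (G : graph V) (H : graph W)
    (coreG : R_core G) (coreH : R_core H) (equivGH : weakly_rel_equiv G H) :
  isomorphic G H.
Proof.
have equivHG := weakly_rel_equiv_sym equivGH.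
have [f inj_f /hom_edges sub_f] := R_core_injective_hom coreG equivGH.
have [g inj_g /hom_edges sub_g] := R_core_injective_hom coreH equivHG.
(* The map induced by [g] embeds [edges H] into [edges G], so the injective image of [edges G] under
   [f] is too large to be a proper subset of [edges H]. *)
have eq_edges : edge_map f @: edges G = edges H.
  apply/eqP; rewrite eqEcard sub_f card_imset; last exact: edge_map_inj.
  by rewrite -(card_imset _ (edge_map_inj inj_g)) subset_leq_card.
(* Minimality of [H] gives [#|W| <= #|V|], so the injection [f] is onto. *)
exists f; split; first exact: inj_card_bij (coreH _ _ equivHG).
move=> u v; rewrite -eq_edges -[(f u, f v)]/(edge_map f (u, v)).
by rewrite mem_imset //; apply: edge_map_inj.
Qed.
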